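(* Let $R$ be a Kähler algebraic curvature operator on a complex Euclidean vector space $(V,g,J)$ of complex dimension $m\geq1$, with scalar curvature $S$, and let $\{e_1,\dots,e_m,Je_1,\dots,Je_m\}$ be an orthonormal basis of $V$. Define $$\varphi^-_{ij}=\tfrac12\left(e_i\odot e_j+Je_i\odot Je_j\right),\qquad \psi^-_{ij}=\tfrac12\left(e_i\odot Je_j-Je_i\odot e_j\right)\qquad(1\leq i<j\leq m),$$ and, for $1\leq k\leq m-1$, $$\eta_k=\frac{k}{\sqrt{8k(k+1)}}\left(e_{k+1}\odot e_{k+1}+Je_{k+1}\odot Je_{k+1}\right)-\frac{1}{\sqrt{8k(k+1)}}\sum_{i=1}^k\left(e_i\odot e_i+Je_i\odot Je_i\right).$$ Then $$\sum_{1\leq i<j\leq m}\left(\mathring{R}(\varphi^-_{ij},\varphi^-_{ij})+\mathring{R}(\psi^-_{ij},\psi^-_{ij})\right)+\sum_{k=1}^{m-1}\mathring{R}(\eta_k,\eta_k)=-\frac{m-1}{2m}S.$$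
   Context: A complex Euclidean vector space $(V,g,J)$ of complex dimension $m$ is a real inner product space $(V,g)$ of real dimension $2m$ with an endomorphism $J$ satisfying $J^2=-\operatorname{id}$ and $g(JX,JY)=g(X,Y)$. An algebraic curvature operator on $V$ is a 4-linear form $R$ on $V$ with $R(X,Y,Z,W)=-R(Y,X,Z,W)=-R(X,Y,W,Z)=R(Z,W,X,Y)$ and satisfying the first Bianchi identity $R(X,Y,Z,W)+R(Y,Z,X,W)+R(Z,X,Y,W)=0$. It is called Kähler if moreover $R(X,Y,Z,W)=R(X,Y,JZ,JW)$ for all $X,Y,Z,W\in V$. The sign convention is that $R(X,Y,X,Y)$ is the sectional curvature for orthonormal $X,Y$; the scalar curvature is $S=\sum_{a,b}R(E_a,E_b,E_a,E_b)$ for an orthonormal basis $\{E_a\}$ of $V$. $V$ is identified with $V^*$ via $g$, with $(e_i\otimes e_j)(e_k,e_l)=\delta_{ik}\delta_{jl}$ for an orthonormal basis, and $u\odot v=u\otimes v+v\otimes u$. The curvature operator of the second kind is the symmetric bilinear form on traceless symmetric two-tensors given in an orthonormal basis of $V$ by $\mathring{R}(\varphi,\psi)=\sum_{i,j,k,l}R_{ijkl}\varphi_{il}\psi_{jk}$. *)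

(* Defs.v *)
From HB Require Import structures.
From mathcomp Require Import all_boot all_order all_algebra.
From mathcomp Require Import boolp functions reals.

Set Implicit Arguments.
Unset Strict Implicit.
Unset Printing Implicit Defensive.

Import Order.TTheory GRing.Theory Num.Theory.
Local Open Scope ring_scope.

Section Curvature.
Variables (K : realType) (V : vectType K).

(* The inner product is a positive definite symmetric bilinear form; the     *)
(* complex dimension is m, so the real dimension is 2m.                      *)
Record complex_euclidean (g : {dot V for @idfun K}) (J : 'End(V)) (m : nat) :
    Prop := ComplexEuclidean {
  complex_euclidean_dim : \dim {:V} = (2 * m)%N;
  complex_euclidean_sqr : forall x, J (J x) = - x;
  complex_euclidean_isom : forall x y, g (J x) (J y) = g x y
}.

Definition orthonormal_basis (g : {dot V for @idfun K}) (E : seq V) : bool :=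
  basis_of {:V} E && orthonormal g E.

Record algebraic_curvature (R : V -> V -> V -> V -> K) : Prop :=
    AlgebraicCurvature {
  curv_linear1 : forall y z w, scalar (fun x => R x y z w);
  curv_linear2 : forall x z w, scalar (fun y => R x y z w);
  curv_linear3 : forall x y w, scalar (fun z => R x y z w);
  curv_linear4 : forall x y z, scalar (fun w => R x y z w);
  curv_skew12 : forall x y z w, R x y z w = - R y x z w;
  curv_skew34 : forall x y z w, R x y z w = - R x y w z;
  curv_pair : forall x y z w, R x y z w = R z w x y;
  curv_bianchi : forall x y z w, R x y z w + R y z x w + R z x y w = 0
}.

Record kahler_curvature (J : 'End(V)) (R : V -> V -> V -> V -> K) : Prop :=
    KahlerCurvature {
  kahler_algebraic : algebraic_curvature R;
  kahler_J : forall x y z w, R x y z w = R x y (J z) (J w)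
}.

(* R x y x y is the sectional curvature of an orthonormal pair (x, y). *)
Definition scalar_curvature (R : V -> V -> V -> V -> K) (E : seq V) : K :=
  \sum_(x <- E) \sum_(y <- E) R x y x y.

(* Two-tensors are functions of two vector arguments, V being identified     *)
(* with its dual through g; K^o provides the pointwise linear structure.     *)
Definition tensor2 : Type := V -> V -> K^o.

Definition tens (g : {dot V for @idfun K}) (u v : V) : tensor2 :=
  fun x y => g u x * g v y.

Definition odot (g : {dot V for @idfun K}) (u v : V) : tensor2 :=
  tens g u v + tens g v u.

(* The sum over i, j, k, l of R_ijkl phi_il psi_jk in the basis E. The       *)
(* formula is used on all two-tensors, and gives the curvature operator of   *)
(* the second kind when phi and psi are symmetric and traceless.             *)
Definition curv_second_kind (R : V -> V -> V -> V -> K) (E : seq V)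
    (phi psi : tensor2) : K :=
  \sum_(x <- E) \sum_(y <- E) \sum_(z <- E) \sum_(w <- E)
    R x y z w * (phi x w : K) * (psi y z : K).

(* The vectors e_1, ..., e_m are the entries 0, ..., m - 1 of the sequence e. *)
Definition phi_minus (g : {dot V for @idfun K}) (J : 'End(V)) (e : seq V)
    (i j : nat) : tensor2 :=
  (2^-1 : K) *: (odot g e`_i e`_j + odot g (J e`_i) (J e`_j)).

Definition psi_minus (g : {dot V for @idfun K}) (J : 'End(V)) (e : seq V)
    (i j : nat) : tensor2 :=
  (2^-1 : K) *: (odot g e`_i (J e`_j) - odot g (J e`_i) e`_j).

(* Here k is counted from 1, for 1 <= k <= m - 1, and e_(k+1) is e`_k.     *)
Definition eta_tensor (g : {dot V for @idfun K}) (J : 'End(V)) (e : seq V)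
    (k : nat) : tensor2 :=
  let c : K := Num.sqrt (8 * k%:R * (k%:R + 1)) in
  (k%:R / c) *: (odot g e`_k e`_k + odot g (J e`_k) (J e`_k))
  - c^-1 *: \sum_(i < k) (odot g e`_i e`_i + odot g (J e`_i) (J e`_i)).

End Curvature.

(* Main.v *)
Require Import Defs.
From HB Require Import structures.
From mathcomp Require Import all_boot all_order all_algebra.
From mathcomp Require Import boolp functions reals.
From mathcomp Require Import ring lra.

(* Let Q be the curvature operator of the second kind, and put               *)
(* s(x, y) = R(x, y, x, y) + R(x, Jy, x, Jy), which the Bianchi               *)
(* identity turns into the symmetric expression R(x, Jx, y, Jy). With         *)
(* h(u, v) = u . v + Ju . Jv (symmetric products), phi_ij = h(e_i, e_j) / 2,  *)
(* psi_ij = h(e_i, Je_j) / 2, and eta_k is a combination of the h(e_i, e_i).  *)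
(* The Kaehler symmetries give                                                *)
(*   Q(h(x, y), h(x, y)) = -8 R(x, Jy, x, Jy),                                *)
(*   Q(h(x, x), h(y, y)) = -8 s(x, y),                                        *)
(* so each pair (phi_ij, psi_ij) contributes -2 s(e_i, e_j), while the eta_k, *)
(* an orthonormal basis of the orthogonal complement of g in the span of the  *)
(* h(e_i, e_i), contribute - sum_i s(e_i, e_i) + (1/m) sum_ij s(e_i, e_j).    *)
(* The claim follows since S = 2 sum_ij s(e_i, e_j).                          *)

Set Implicit Arguments.
Unset Strict Implicit.

Import Order.TTheory GRing.Theory Num.Theory.
Local Open Scope ring_scope.

Lemma sum_sym_triangle (K : comPzRingType) (s : nat -> nat -> K) (m : nat) :
  (forall i j, s i j = s j i) ->
  \sum_(i < m) \sum_(j < m) s i j =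
  2 * \sum_(i < m) \sum_(j < m | (i < j)%N) s i j + \sum_(i < m) s i i.
Proof.
move=> sC.
have -> : \sum_(i < m) \sum_(j < m) s i j =
    \sum_(i < m) (\sum_(j < m | (i < j)%N) s i j +
                  (\sum_(j < m | (j < i)%N) s i j + s i i)).
  apply: eq_bigr => i _.
  rewrite (bigID (fun j : 'I_m => (i < j)%N)) /=; congr (_ + _).
  rewrite (bigD1 i) ?ltnn //= addrC; congr (_ + _).
  by apply: eq_bigl => j; rewrite -leqNgt ltn_neqAle andbC.
rewrite !big_split /= addrA mulr_natl mulr2n; congr (_ + _ + _).
rewrite (exchange_big_dep xpredT) //=; apply: eq_bigr => i _.
by apply: eq_bigr => j _; rewrite sC.
Qed.

Lemma sum_square_recr (K : comPzRingType) (H : nat -> nat -> K) (k : nat) :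
  (forall i j, H i j = H j i) ->
  \sum_(i < k.+1) \sum_(j < k.+1) H i j =
  \sum_(i < k) \sum_(j < k) H i j + 2 * \sum_(i < k) H k i + H k k.
Proof.
move=> HC; rewrite big_ord_recr /= [X in _ + X = _]big_ord_recr /=.
under eq_bigr do rewrite big_ord_recr /=.
rewrite big_split /= mulr_natl mulr2n !addrA; congr (_ + _ + _ + _).
by apply: eq_bigr => i _.
Qed.

Lemma sum_eta_telescope (K : numFieldType) (H : nat -> nat -> K) (m : nat) :
  (forall i j, H i j = H j i) -> (0 < m)%N ->
  \sum_(1 <= k < m) (8 * k%:R * (k%:R + 1))^-1 *
     (k%:R ^+ 2 * H k k - 2 * k%:R * (\sum_(i < k) H k i)
      + \sum_(i < k) \sum_(j < k) H i j) =
  8^-1 * (\sum_(i < m) H i i - m%:R^-1 * \sum_(i < m) \sum_(j < m) H i j).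
Proof.
move=> HC; case: m => // m _; elim: m => [|m IHm].
  by rewrite big_geq // !big_ord1 invr1 mul1r subrr mulr0.
rewrite big_nat_recr //= IHm [in RHS]big_ord_recr /= [in RHS]sum_square_recr //.
rewrite -!(natr1 m.+1).
have m0 : m.+1%:R != 0 :> K by rewrite pnatr_eq0.
have m1 : m.+1%:R + 1 != 0 :> K by rewrite natr1 pnatr_eq0.
by field; rewrite !(addrC 1) natr1 m0 m1.
Qed.

Section OrthonormalBasis.
Variables (K : realType) (V : vectType K) (g : {dot V for @idfun K}).
Implicit Type E F : seq V.

Lemma orthonormal_nth (s : seq V) (i j : nat) :
  orthonormal g s -> (i < size s)%N -> (j < size s)%N ->
  g s`_i s`_j = (i == j)%:R.
Proof.
case/andP=> /allP s1 so.
have {}so : pairwise (fun u v => g u v == 0) s.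
  elim: s so {s1} => //= u s IHs /andP[us /IHs ->]; rewrite andbT.
  by move: us; rewrite /orthogonal /= andbT.
have g0 a b : (a < b)%N -> (b < size s)%N -> g s`_a s`_b = 0.
  move=> ab bs; apply/eqP; move/(pairwiseP 0): so; apply=> //.
  exact: ltn_trans bs.
move=> li lj; case: (ltngtP i j) => [ij|ji|<-]; first exact: g0.
  by rewrite hermC expr0 mul1r /= g0.
by apply/eqP/s1/mem_nth.
Qed.

Lemma orthonormal_expansion F v :
  orthonormal_basis g F -> v = \sum_(x <- F) g v x *: x.
Proof.
case/andP=> bF oF.
have {1}-> := coord_basis (X := in_tuple F) bF (memvf v).
rewrite (big_nth 0) big_mkord; apply: eq_bigr => i _; congr (_ *: _).
have {2}-> := coord_basis (X := in_tuple F) bF (memvf v).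
rewrite linear_sumlz /= (bigD1 i) //= big1 => [|j ji].
  by rewrite linearZl_LR /= orthonormal_nth // eqxx mulr1 addr0.
by rewrite linearZl_LR /= orthonormal_nth // (inj_eq val_inj) (negPf ji) mulr0.
Qed.

Lemma sum_orthonormal_basis F (f : V -> K) v :
  orthonormal_basis g F -> scalar f -> \sum_(x <- F) g v x * f x = f v.
Proof.
move=> bF lf; pose fL := GRing.isLinear.Build K V K *%R f lf.
pose fl : {scalar V} := HB.pack f fL.
rewrite [in RHS](orthonormal_expansion v bF) -[f in RHS]/(fl : V -> K).
by rewrite linear_sum; apply: eq_bigr => x _; rewrite linearZ.
Qed.

Lemma trace_orthonormal_basis E F (B : V -> V -> K) :
  orthonormal_basis g E -> orthonormal_basis g F ->
  (forall y, scalar (B^~ y)) -> (forall x, scalar (B x)) ->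
  \sum_(x <- E) B x x = \sum_(x <- F) B x x.
Proof.
move=> bE bF l1 l2.
under eq_bigr => x _ do rewrite -(sum_orthonormal_basis x bF (l2 x)).
rewrite exchange_big; apply: eq_bigr => y _ /=.
rewrite -(sum_orthonormal_basis y bE (l1 y)).
by apply: eq_bigr => x _; rewrite hermC expr0 mul1r.
Qed.

End OrthonormalBasis.

Section SecondKindBilinear.
Variables (K : realType) (V : vectType K).
Variables (R : V -> V -> V -> V -> K) (F : seq V).
Local Notation Q := (curv_second_kind R F).

Lemma curv_second_kind_bilinear :
  bilinear_for *%R *%R (Q : (V -> V -> K^o) -> (V -> V -> K^o) -> K).
Proof.
split=> [psi|phi] c f h /=; rewrite /curv_second_kind mulr_sumr -big_split /=;
  apply: eq_bigr => x _; rewrite mulr_sumr -big_split /=;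
  apply: eq_bigr => y _; rewrite mulr_sumr -big_split /=;
  apply: eq_bigr => z _; rewrite mulr_sumr -big_split /=;
  apply: eq_bigr => w _; rewrite !fctE /= -![_ *: _]/(_ * _);
  by rewrite mulrDr ?mulrDl; congr (_ + _); rewrite mulrCA -?mulrA.
Qed.

HB.instance Definition _ :=
  bilinear_isBilinear.Build K (V -> V -> K^o) (V -> V -> K^o) K
    *%R *%R Q curv_second_kind_bilinear.

End SecondKindBilinear.

Section AlgebraicCurvature.
Variables (K : realType) (V : vectType K) (g : {dot V for @idfun K}).
Variables (R : V -> V -> V -> V -> K) (aR : algebraic_curvature R).

Lemma curvN1 x y z w : R (- x) y z w = - R x y z w.
Proof.
have R0 : R 0 y z w = 0.
  by have := curv_linear1 aR y z w 1 0 0; rewrite scaler0 addr0 mul1r; lra.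
have := curv_linear1 aR y z w (-1) x 0.
by rewrite addr0 R0 addr0 scaleN1r mulN1r.
Qed.

Lemma curvN2 x y z w : R x (- y) z w = - R x y z w.
Proof. by rewrite (curv_skew12 aR) curvN1 -(curv_skew12 aR). Qed.

Lemma curvN4 x y z w : R x y z (- w) = - R x y z w.
Proof. by rewrite (curv_pair aR) curvN2 (curv_pair aR). Qed.

Lemma curv_diag12 x z w : R x x z w = 0.
Proof. by have := curv_skew12 aR x x z w; lra. Qed.

Lemma curv_second_kind_tens (F : seq V) (u v w z : V) :
  orthonormal_basis g F ->
  curv_second_kind R F (tens g u v) (tens g w z) = R u w z v.
Proof.
move=> bF; rewrite -(sum_orthonormal_basis _ bF (curv_linear1 aR w z v)).
apply: eq_bigr => x _.
rewrite -(sum_orthonormal_basis _ bF (curv_linear2 aR x z v)) mulr_sumr.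
apply: eq_bigr => y _.
rewrite -(sum_orthonormal_basis _ bF (curv_linear3 aR x y v)) !mulr_sumr.
apply: eq_bigr => t _.
rewrite -(sum_orthonormal_basis _ bF (curv_linear4 aR x y t)) !mulr_sumr.
by apply: eq_bigr => s _; rewrite /tens; ring.
Qed.

Lemma scalar_curvature_basis (E E' : seq V) :
  orthonormal_basis g E -> orthonormal_basis g E' ->
  scalar_curvature R E = scalar_curvature R E'.
Proof.
move=> bE bE'; rewrite /scalar_curvature.
transitivity (\sum_(x <- E) \sum_(y <- E') R x y x y).
  apply: eq_bigr => x _.
  apply: (trace_orthonormal_basis (B := fun y y' => R x y x y') bE bE') => y.
    exact: curv_linear2.
  exact: curv_linear4.
rewrite exchange_big [RHS]exchange_big /=; apply: eq_bigr => y _.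
apply: (trace_orthonormal_basis (B := fun x x' => R x y x' y) bE bE') => x.
  exact: curv_linear1.
exact: curv_linear3.
Qed.

End AlgebraicCurvature.

Section KahlerCurvature.
Variables (K : realType) (V : vectType K) (g : {dot V for @idfun K}).
Variables (J : 'End(V)) (JJ : forall x, J (J x) = - x).

Definition jodot u v : tensor2 V := odot g u v + odot g (J u) (J v).

Lemma phi_minusE (e : seq V) i j :
  phi_minus g J e i j = 2^-1 *: jodot e`_i e`_j.
Proof. by []. Qed.

Lemma psi_minusE (e : seq V) i j :
  psi_minus g J e i j = 2^-1 *: jodot e`_i (J e`_j).
Proof.
rewrite /psi_minus /jodot JJ; congr (_ *: (_ + _)).
apply/funext => x; apply/funext => y.
by rewrite /odot /tens !fctE /= !linearNl /= opprD mulrN mulNr.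
Qed.

Variables (R : V -> V -> V -> V -> K) (hR : kahler_curvature J R).
Let aR := kahler_algebraic hR.

Lemma kahler_J12 x y z w : R (J x) (J y) z w = R x y z w.
Proof. by rewrite (curv_pair aR) -(kahler_J hR) -(curv_pair aR). Qed.

Lemma kahler_J1 x y z w : R (J x) y z w = - R x (J y) z w.
Proof. by rewrite -kahler_J12 JJ (curvN1 aR). Qed.

Lemma kahler_J3 x y z w : R x y (J z) w = - R x y z (J w).
Proof. by rewrite (curv_pair aR) kahler_J1 (curv_pair aR). Qed.

Lemma kahler_J2C x y z w : R x (J y) z w = R y (J x) z w.
Proof. by rewrite (curv_skew12 aR) kahler_J1 opprK. Qed.

Lemma kahler_J4C x y z w : R x y z (J w) = R x y w (J z).
Proof. by rewrite (curv_pair aR) kahler_J2C (curv_pair aR). Qed.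

(* Moves every J into the second and fourth slots. *)
Let JE := (kahler_J1, kahler_J3, JJ, curvN2 aR, curvN4 aR, @opprK K).

Definition curv_complex_line x y := R x y x y + R x (J y) x (J y).
Local Notation s := curv_complex_line.

Lemma curv_complex_lineE x y : R x (J x) y (J y) = s x y.
Proof.
have := curv_bianchi aR x (J x) y (J y); rewrite /s.
rewrite kahler_J1 kahler_J3 JJ (curvN4 aR) (curv_skew12 aR y x); lra.
Qed.

Lemma curv_complex_lineC x y : s x y = s y x.
Proof. by rewrite -!curv_complex_lineE (curv_pair aR). Qed.

Lemma scalar_curvature_complex (e : seq V) :
  scalar_curvature R (e ++ [seq J x | x <- e]) =
  2 * \sum_(x <- e) \sum_(y <- e) s x y.
Proof.
rewrite /scalar_curvature big_cat /= big_map -big_split mulr_sumr /=.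
apply: eq_bigr => x _; rewrite !big_cat /= !big_map -!big_split mulr_sumr /=.
by apply: eq_bigr => y _; rewrite !JE /s; ring.
Qed.

Variables (F : seq V) (bF : orthonormal_basis g F).
Local Notation Q := (curv_second_kind R F).

Lemma curv_second_kind_jodot u v w z :
  Q (jodot u v) (jodot w z) =
  2 * (R u w z v + R u z w v + R v w z u + R v z w u) -
  2 * (R u (J w) z (J v) + R u (J z) w (J v) +
       R v (J w) z (J u) + R v (J z) w (J u)).
Proof.
rewrite /jodot /odot !linearDl /= !linearDr /=.
rewrite !(curv_second_kind_tens aR _ _ _ _ bF) !JE; lra.
Qed.

Lemma curv_second_kind_jodot_self x y :
  Q (jodot x y) (jodot x y) = - 8 * R x (J y) x (J y).
Proof.
rewrite curv_second_kind_jodot !(curv_diag12 aR).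
rewrite (kahler_J2C y) (kahler_J4C x _ y x) (curv_pair aR y (J y)).
rewrite (curv_skew12 aR y x) (curv_skew34 aR x y y x) curv_complex_lineE /s; lra.
Qed.

Lemma curv_second_kind_jodot_diag x y :
  Q (jodot x x) (jodot y y) = - 8 * s x y.
Proof.
rewrite curv_second_kind_jodot (curv_skew34 aR x y y x) (kahler_J4C x _ y x) /s.
lra.
Qed.

Lemma curv_second_kind_phi_psi (e : seq V) (i j : nat) :
  Q (phi_minus g J e i j) (phi_minus g J e i j) +
  Q (psi_minus g J e i j) (psi_minus g J e i j) = - 2 * s e`_i e`_j.
Proof.
rewrite phi_minusE psi_minusE !linearZl_LR /= !linearZr_LR /=.
rewrite !curv_second_kind_jodot_self JJ (curvN2 aR) (curvN4 aR) /s; lra.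
Qed.

Lemma curv_second_kind_eta (e : seq V) (k : nat) :
  let H i j := - 8 * s e`_i e`_j in
  Q (eta_tensor g J e k) (eta_tensor g J e k) =
  (8 * k%:R * (k%:R + 1))^-1 *
    (k%:R ^+ 2 * H k k - 2 * k%:R * (\sum_(i < k) H k i)
     + \sum_(i < k) \sum_(j < k) H i j).
Proof.
move=> H; pose t i := jodot e`_i e`_i.
pose T : tensor2 V := \sum_(i < k) t i.
have QtT i : Q (t i) T = \sum_(j < k) H i j.
  rewrite linear_sumr /=; apply: eq_bigr => j _.
  by rewrite curv_second_kind_jodot_diag.
have QTt j : Q T (t j) = \sum_(i < k) H j i.
  rewrite linear_sumlz /=; apply: eq_bigr => i _.
  by rewrite curv_second_kind_jodot_diag curv_complex_lineC.
have QTT : Q T T = \sum_(i < k) \sum_(j < k) H i j.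
  by rewrite linear_sumlz /=; apply: eq_bigr => i _; rewrite QtT.
set c : K := 8 * k%:R * (k%:R + 1).
have c0 : 0 <= c by rewrite !mulr_ge0 ?addr_ge0 ?ler0n.
have cV : c^-1 = (Num.sqrt c)^-1 ^+ 2 by rewrite exprVn sqr_sqrtr.
have -> : eta_tensor g J e k =
    (k%:R / Num.sqrt c) *: t k - (Num.sqrt c)^-1 *: T by [].
rewrite linearBl /= !linearBr /= !linearZl_LR /= !linearZr_LR /=.
rewrite QTT QTt QtT curv_second_kind_jodot_diag -/(H k k) cV; ring.
Qed.

End KahlerCurvature.

Unset Implicit Arguments.
Set Strict Implicit.

Theorem lemma4p4 (K : realType) (V : vectType K) (g : {dot V for @idfun K})
    (J : 'End(V)) (m : nat) (hm : (1 <= m)%N) (hV : complex_euclidean g J m)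
    (R : V -> V -> V -> V -> K) (hR : kahler_curvature J R)
    (e : m.-tuple V) (he : orthonormal_basis g (e ++ [seq J x | x <- e]))
    (E : seq V) (hE : orthonormal_basis g E)
    (F : seq V) (hF : orthonormal_basis g F) :
  \sum_(i < m) \sum_(j < m | (i < j)%N)
      (curv_second_kind R F (phi_minus g J e i j) (phi_minus g J e i j) +
       curv_second_kind R F (psi_minus g J e i j) (psi_minus g J e i j)) +
    \sum_(1 <= k < m) curv_second_kind R F (eta_tensor g J e k) (eta_tensor g J e k)
  = - ((m%:R - 1) / (2 * m%:R)) * scalar_curvature R E.
Proof.
have JJ := complex_euclidean_sqr hV.
pose s i j := curv_complex_line J R e`_i e`_j.
have sC i j : s i j = s j i by apply: (curv_complex_lineC JJ hR).
have eta : \sum_(1 <= k < m)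
      curv_second_kind R F (eta_tensor g J e k) (eta_tensor g J e k) =
    8^-1 * (\sum_(i < m) - 8 * s i i
            - m%:R^-1 * \sum_(i < m) \sum_(j < m) - 8 * s i j).
  rewrite -(sum_eta_telescope (H := fun i j => - 8 * s i j)) //.
    by apply: eq_bigr => k _; apply: (curv_second_kind_eta JJ hR hF).
  by move=> i j; rewrite sC.
have S : scalar_curvature R E = 2 * \sum_(i < m) \sum_(j < m) s i j.
  rewrite (scalar_curvature_basis (kahler_algebraic hR) hE he).
  rewrite (scalar_curvature_complex JJ hR); congr (_ * _).
  rewrite (big_nth 0) size_tuple big_mkord; apply: eq_bigr => i _.
  by rewrite (big_nth 0) size_tuple big_mkord.
rewrite {}eta {}S.
under eq_bigr do under eq_bigr do
  rewrite (curv_second_kind_phi_psi JJ hR hF) -/(s _ _).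
under eq_bigr do rewrite -mulr_sumr.
under [X in _ + _ * (_ - _ * X)]eq_bigr do rewrite -mulr_sumr.
rewrite -!mulr_sumr (sum_sym_triangle _ sC).
have m0 : m%:R != 0 :> K by rewrite pnatr_eq0 -lt0n.
by field.
Qed.
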